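(* Let $d \geq 0$ and $r \geq 2$ be integers. If $G$ is a graph of maximum degree at most $d$ satisfying $\chi(G) \leq r$, then \[\chi_P(G) \leq AT(G) \leq \left(1 - \frac{1}{4r+1}\right) d + 2.\]
   Context: All graphs are finite and simple. $\chi(G)$ is the chromatic number. Paintability: given $f:V(G)\to\mathbb N$, in the $f$-painting game each vertex $v$ starts with $f(v)$ tokens. On each turn $i$, Lister removes at most one token from each vertex, letting $S_i$ be the (nonempty) set of vertices that lost a token; Painter then colors an independent subset of $S_i$ with color $i$ (a vertex once colored stays colored). The game ends when all tokens are gone; Painter wins if every vertex has been colored. $G$ is $f$-paintable if Painter has a winning strategy; $\chi_P(G)$ is the minimum $k$ such that $G$ is $f$-paintable for the constant function $f\equiv k$. Alon–Tarsi number: for an orientation $\vec G$ of $G$, a spanning subgraph $\vec H$ (same vertex set) is Eulerian if $\deg^+_{\vec H}(v)=\deg^-_{\vec H}(v)$ for all $v$; it is even or odd according to the parity of $|E(\vec H)|$. Let $EE(\vec G)$, $EO(\vec G)$ be the numbers of even and odd Eulerian subgraphs. $\vec G$ is an Alon–Tarsi orientation if $EE(\vec G)\neq EO(\vec G)$. $AT(G)$ is the minimum $k$ such that $G$ has an Alon–Tarsi orientation with $\deg^+(v) < k$ for every vertex $v$. *)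

(* Defs.v *)
(* Graphs: a simple graph on a finType T is a symmetric,
   irreflexive relation e : rel T. *)
From mathcomp Require Import all_boot all_order all_algebra.
From mathcomp Require Import boolp.

Set Implicit Arguments.
Unset Strict Implicit.
Unset Printing Implicit Defensive.

Section GraphDefs.
Variable T : finType.
Variable e : rel T.

Definition independent (I : {set T}) : bool :=
  [forall u in I, forall v in I, ~~ e u v].

Definition colorable (k : nat) : bool :=
  [exists c : {ffun T -> 'I_k}, [forall u, forall v, e u v ==> (c u != c v)]].

(* minimum k with a proper k-coloring; a simple graph is always
   #|T|-colorable, so the default value #|T| is the true minimum if reached. *)
Definition chromatic_number : nat :=
  \big[minn/#|T|]_(k < #|T|.+1 | colorable k) (k : nat).

(** The f-painting game.  [painter_wins f U] : Painter has a winning strategy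
    from the position where vertex v carries f v tokens and U is the set of
    still uncolored vertices.  The game is finite, so winning positions are
    the least fixed point below. *)
Inductive painter_wins : (T -> nat) -> {set T} -> Prop :=
| pw_end (f : T -> nat) (U : {set T}) :
    (forall v, f v = 0) -> U = set0 -> painter_wins f U
| pw_step (f : T -> nat) (U : {set T}) :
    (exists v, 0 < f v) ->
    (forall S : {set T}, S != set0 -> (forall v, v \in S -> 0 < f v) ->
       exists I : {set T}, I \subset S /\ independent I /\
         painter_wins (fun v => f v - (v \in S)) (U :\: I)) ->
    painter_wins f U.

Definition paintable (f : T -> nat) : Prop := painter_wins f setT.

(* paint number: minimum k such that G is (constant k)-paintable; a simple
   graph is always #|T|-paintable, so the default is never reached. *)
Definition paint_number : nat :=
  \big[minn/#|T|.+1]_(k < #|T|.+1 | `[< paintable (fun _ => k) >]) (k : nat).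

Definition is_orientation (o : {set T * T}) : bool :=
  [forall u, forall v, e u v ==> (((u, v) \in o) (+) ((v, u) \in o))] &&
  [forall p in o, e p.1 p.2].

Definition outdeg (H : {set T * T}) (v : T) : nat := #|[set p in H | p.1 == v]|.
Definition indeg (H : {set T * T}) (v : T) : nat := #|[set p in H | p.2 == v]|.

Definition eulerian (H : {set T * T}) : bool := [forall v, outdeg H v == indeg H v].

Definition EE (o : {set T * T}) : nat :=
  #|[set H : {set T * T} | (H \subset o) && eulerian H && ~~ odd #|H|]|.
Definition EO (o : {set T * T}) : nat :=
  #|[set H : {set T * T} | (H \subset o) && eulerian H && odd #|H|]|.

Definition AT_orientation (o : {set T * T}) : bool :=
  is_orientation o && (EE o != EO o).

(* AT(G) = min over AT orientations o of (max outdegree of o) + 1, i.e. the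
   least k such that some AT orientation has all outdegrees < k.  An acyclic
   orientation is always AT, so the default #|T|.+1 is never reached. *)
Definition AT_number : nat :=
  \big[minn/#|T|.+1]_(o : {set T * T} | AT_orientation o)
     (\max_(v : T) outdeg o v).+1.

End GraphDefs.

(* Main.v *)
(** The inequality chi_P <= AT is Schauz's theorem. Let N(D, a) be the
coefficient of prod_v x_v^(a v) in the graph polynomial prod (x_u - x_v), that
is, a signed count of the orientations with outdegrees a. Painter keeps
N(D, a) <> 0 with a < f on the uncoloured vertices; at the start
N(D, outdeg D) = EE - EO. When Lister plays S, homogeneity lets one replace
"deg = a" by "deg >= a" on S; expanding "deg >= a" as 1 - "deg < a" at each
vertex of S yields a set I on which the degree is free and off which it is
< a on S, with nonzero signed count. Reversing an arc inside I would cancel the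
count, so I is independent and Painter colours it.

For the upper bound put k = 4rd / (4r + 1) + 1, rounded down. Every nonempty
vertex set W has a nonempty X inducing a bipartite graph with
deg_X v >= 2 (deg_W v - k) on X: either a single vertex of degree at most k, or
else the average degree in W exceeds k, and were all unions of two colour
classes degenerate, W would have too few edges. Orient X with
indegree at least deg_W v - k and all edges from X to W \ X outwards, and
recurse on W \ X. All Eulerian subgraphs of the result are even, since they
avoid the edges between pieces and the pieces are bipartite. *)
Require Import Defs.
From mathcomp Require Import all_boot all_order all_algebra.
From mathcomp Require Import boolp.
From mathcomp Require Import zify.
Import GRing.Theory Num.Theory.


(** * Minima over finite types, and fibres of nonzero sums *)

Lemma bigminn_leq (I : finType) (P : pred I) (F : I -> nat) (x0 : nat) (i : I) :
  P i -> \big[minn/x0]_(j | P j) F j <= F i.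
Proof.
move=> Pi; elim: (index_enum I) (mem_index_enum i) => // j s IH.
rewrite inE big_cons => /predU1P[<-|/IH le]; first by rewrite Pi geq_minl.
by case: ifP => // _; apply: leq_trans (geq_minr _ _) le.
Qed.

Lemma bigminn_leq_default (I : finType) (P : pred I) (F : I -> nat) (x0 : nat) :
  \big[minn/x0]_(j | P j) F j <= x0.
Proof. by elim/big_rec: _ => // i m _; apply: leq_trans (geq_minr _ _). Qed.

Lemma bigminn_attained (I : finType) (P : pred I) (F : I -> nat) (x0 : nat) :
  \big[minn/x0]_(j | P j) F j = x0 \/
  exists2 i, P i & \big[minn/x0]_(j | P j) F j = F i.
Proof.
elim/big_rec: _ => [|i m Pi IH]; first by left.
by rewrite /minn; case: ltnP => _ //; right; exists i.
Qed.

Lemma sum_neq0_fiber (I : finType) (K : eqType) (h : I -> K) (P : pred I)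
    (w : I -> int) :
  (\sum_(x | P x) w x != 0)%R ->
  exists2 x0, P x0 & (\sum_(x | P x && (h x == h x0)) w x != 0)%R.
Proof.
move=> nz.
(* [K] need not be finite, so the blocks are indexed by the fibres of [h] themselves, as subsets of
   [I]. *)
pose cls x := [set y | h y == h x].
have : (\sum_(C : {set I}) \sum_(x | P x && (cls x == C)) w x != 0)%R.
  by rewrite -(partition_big cls predT).
case: (boolP [exists C : {set I}, (\sum_(x | P x && (cls x == C)) w x != 0)%R]).
  move=> /existsP[C nzC] _.
  have [x0 /andP[Px0 /eqP Cx0]|no] := pickP (fun x => P x && (cls x == C)); last first.
    by move: nzC; rewrite big_pred0 ?eqxx.
  exists x0 => //; apply: etrans nzC; congr (~~ (_ == _)); apply: eq_bigl => x; congr (_ && _).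
  rewrite -Cx0; apply/idP/idP => /eqP E; first by apply/eqP/setP => y; rewrite !inE E.
  by move/setP/(_ x): E; rewrite !inE eqxx => <-.
rewrite negb_exists => /forallP z /negP[]; apply/eqP/big1 => C _.
by apply/eqP; move: (z C); rewrite negbK.
Qed.

(** * Signed counts of orientations and the painting game *)

Section SignedCount.
Variable T : finType.
Implicit Types (D E R : {set T * T}) (a : T -> nat) (S I U : {set T}) (v : T).

(* A set R of reversed arcs encodes an orientation of the underlying graph
   of D. *)
Definition tail R (p : T * T) : T := if p \in R then p.2 else p.1.

Definition rev_outdeg D R v : nat := \sum_(p in D) (tail R p == v).

(* Up to sign, the coefficient of prod_v x_v^(a v) in the graph polynomial
   prod_((u, v) in D) (x_u - x_v). *)
Definition signed_count D a : int :=
  (\sum_(R : {set T * T} | (R \subset D) && [forall v, rev_outdeg D R v == a v])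
     (-1) ^+ #|R|)%R.

Lemma outdegE D v : outdeg D v = \sum_(p in D) (p.1 == v).
Proof.
rewrite /outdeg -sum1_card -big_mkcondr /=.
by apply: eq_bigl => p; rewrite inE.
Qed.

Lemma indegE D v : indeg D v = \sum_(p in D) (p.2 == v).
Proof.
rewrite /indeg -sum1_card -big_mkcondr /=.
by apply: eq_bigl => p; rewrite inE.
Qed.

Lemma sum_rev_outdeg D R : \sum_v rev_outdeg D R v = #|D|.
Proof.
rewrite exchange_big -sum1_card; apply: eq_bigr => p _ /=.
by rewrite (bigD1 (tail R p)) //= eqxx big1 // => v /negPf; rewrite eq_sym => ->.
Qed.

Lemma rev_outdeg_setI D E R v : D \subset E ->
  rev_outdeg D (R :&: E) v = rev_outdeg D R v.
Proof.
by move=> /subsetP sDE; apply: eq_bigr => p /sDE pE; rewrite /tail inE pE andbT.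
Qed.

Lemma rev_outdeg_split D E R v : E \subset D ->
  rev_outdeg D R v = rev_outdeg E R v + rev_outdeg (D :\: E) R v.
Proof.
by move=> /setIidPr sED; rewrite /rev_outdeg (big_setID E) /= sED.
Qed.

(** Reversing [R] replaces its contribution to the outdegree of [v] by its indegree there. Hence
    reversal preserves all outdegrees exactly when [R] is Eulerian. The additive form avoids
    truncated subtraction. *)
Lemma rev_outdeg_eulerian D R v : R \subset D ->
  rev_outdeg D R v + outdeg R v = outdeg D v + indeg R v.
Proof.
move=> sRD; rewrite (@rev_outdeg_split D R) // !outdegE indegE.
rewrite /rev_outdeg [in RHS](big_setID R) /= (setIidPr sRD).
have -> : \sum_(p in R) (tail R p == v) = \sum_(p in R) (p.2 == v).
  by apply: eq_bigr => p pR; rewrite /tail pR.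
have -> : \sum_(p in D :\: R) (tail R p == v) = \sum_(p in D :\: R) (p.1 == v).
  by apply: eq_bigr => p; rewrite inE /tail => /andP[/negPf->].
by rewrite addnC addnCA addnC.
Qed.

Lemma signed_count_outdeg D :
  signed_count D (outdeg D) = ((EE D)%:R - (EO D)%:R)%R.
Proof.
transitivity (\sum_(R : {set T * T} | (R \subset D) && eulerian R) (-1) ^+ #|R| : int)%R.
  apply: eq_bigl => R; apply: andb_id2l => sRD; apply: eq_forallb => v.
  by rewrite -(eqn_add2r (outdeg R v)) rev_outdeg_eulerian // eqn_add2l eq_sym.
rewrite (bigID (fun R => odd #|R|)) /= [LHS]addrC /EE /EO -!sumr_const -sumrN.
by congr (_ + _)%R; apply: eq_big => R; rewrite ?inE // -signr_odd => /andP[_];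
  case: odd.
Qed.

(** Generalises [signed_count] by giving each vertex its own predicate on the outdegree, so that
    conditions can be changed one vertex at a time. *)
Definition constrained_count D (Q : T -> pred nat) : int :=
  (\sum_(R : {set T * T} | (R \subset D) && [forall v, Q v (rev_outdeg D R v)])
     (-1) ^+ #|R|)%R.

Lemma eq_constrained_count D (Q1 Q2 : T -> pred nat) : Q1 =2 Q2 ->
  constrained_count D Q1 = constrained_count D Q2.
Proof.
by move=> E; apply: eq_bigl => R; congr (_ && _); apply: eq_forallb => v; apply: E.
Qed.

Definition set_constraint (Q : T -> pred nat) x q v : pred nat :=
  if v == x then q else Q v.

Lemma constrained_count_compl D Q x (q : pred nat) :
  constrained_count D (set_constraint Q x predT) =
  (constrained_count D (set_constraint Q x q) +
   constrained_count D (set_constraint Q x (predC q)))%R.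
Proof.
have split_at p R : [forall v, set_constraint Q x p v (rev_outdeg D R v)] =
    p (rev_outdeg D R x) && [forall (v | v != x), Q v (rev_outdeg D R v)].
  apply/forallP/andP => [H|[px /forall_inP H] v].
    split; first by have := H x; rewrite /set_constraint eqxx.
    by apply/forall_inP => v /negPf vx; have := H v; rewrite /set_constraint vx.
  by rewrite /set_constraint; case: eqVneq => [->|/H].
rewrite /constrained_count (bigID (fun R => q (rev_outdeg D R x))) /=.
by congr (_ + _)%R; apply: eq_bigl => R; rewrite !split_at /= -andbA;
  congr (_ && _); rewrite andbC.
Qed.

(* [deg >= a] = 1 - [deg < a], vertex by vertex *)
Lemma constrained_count_expand D a (s : seq T) (Q : T -> pred nat) : uniq s ->
  {in s, forall v, Q v =1 leq (a v)} -> constrained_count D Q != 0%R ->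
  exists2 I : {set T}, {subset I <= s} &
    constrained_count D (fun v n =>
      if v \in s then (v \in I) || (n < a v) else Q v n) != 0%R.
Proof.
elim: s Q => [|x s IH] Q /=; first by exists set0 => // v; rewrite inE.
move=> /andP[xs us] Qge nz.
have Qgex : constrained_count D Q =
    constrained_count D (set_constraint Q x (predC (gtn (a x)))).
  apply: eq_constrained_count => v n; rewrite /set_constraint.
  by case: eqVneq => [->|//]; rewrite Qge ?mem_head //= -leqNgt.
have ge_s q : {in s, forall v, set_constraint Q x q v =1 leq (a v)}.
  move=> v vs; rewrite /set_constraint; case: eqVneq => [E|_].
    by rewrite -E vs in xs.
  by apply: Qge; rewrite inE vs orbT.
(* If the count with degree below [a x] vanishes, freeing the degree at [x] does not change the
   count, and [x] joins [I]. Otherwise the condition [< a x] is kept and [x] stays out of [I]. *)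
case: (eqVneq (constrained_count D (set_constraint Q x (gtn (a x)))) 0%R) => [z|nzx].
  have nzx : constrained_count D (set_constraint Q x predT) != 0%R.
    by rewrite (@constrained_count_compl _ _ _ (gtn (a x))) z add0r -Qgex.
  have [I sI nzI] := IH _ us (ge_s _) nzx.
  exists (x |: I) => [v|].
    by rewrite !inE => /predU1P[->|/sI ->]; rewrite ?eqxx ?orbT.
  apply: etrans nzI; congr (~~ (_ == _)); apply: eq_constrained_count => v n.
  rewrite !inE /set_constraint; case: eqVneq => [->|_] //=.
  by rewrite (negPf xs).
have [I sI nzI] := IH _ us (ge_s _) nzx.
exists I => [v /sI vs|]; first by rewrite inE vs orbT.
apply: etrans nzI; congr (~~ (_ == _)); apply: eq_constrained_count => v n.
rewrite !inE /set_constraint; case: eqVneq => [->|_] //=.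
rewrite (negPf xs); case: (boolP (x \in I)) => // /sI.
by rewrite (negPf xs).
Qed.

Lemma signed_count_relax D a S : signed_count D a != 0%R ->
  exists2 I : {set T}, I \subset S &
    constrained_count D (fun v n =>
      if v \in S then (v \in I) || (n < a v) else n == a v) != 0%R.
Proof.
(* The constant map serves only to extract one [R0] realising [a] from the nonzero sum. It shows
   that [a] sums to [#|D|], as do the outdegrees of every reversal set, so [a] as a pointwise lower
   bound forces equality. *)
move=> nz; have [R0 /andP[_ /forallP eqa] _] := sum_neq0_fiber _ _ (fun=> tt) _ _ nz.
pose Q v n := if v \in S then a v <= n else n == a v.
have nzQ : constrained_count D Q != 0%R.
  apply: etrans nz; congr (~~ (_ == _)); apply: eq_bigl => R; congr (_ && _).
  apply/forallP/forallP => H v; last by rewrite /Q (eqP (H v)); case: ifP.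
  have le w : a w <= rev_outdeg D R w.
    by have := H w; rewrite /Q; case: ifP => // _ /eqP ->.
  have : \sum_v rev_outdeg D R v = \sum_v a v.
    rewrite sum_rev_outdeg -(sum_rev_outdeg D R0).
    by apply: eq_bigr => w _; rewrite (eqP (eqa w)).
  rewrite (bigD1 v) //= [RHS](bigD1 v) //=.
  have := le v; have : \sum_(w | w != v) a w <= \sum_(w | w != v) rev_outdeg D R w.
    by apply: leq_sum => w _.
  by lia.
have [||I sI nzI] := @constrained_count_expand D a (enum S) Q _ _ nzQ.
- exact: enum_uniq.
- by move=> v; rewrite mem_enum /Q => vS n; rewrite vS.
exists I; first by apply/subsetP => v /sI; rewrite mem_enum.
apply: etrans nzI; congr (~~ (_ == _)); apply: eq_constrained_count => v n.
by rewrite mem_enum /Q; case: ifP.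
Qed.

(** Toggling [p] in [R] is a sign-reversing involution. It affects degrees only at the two ends of
    [p], where [Q] imposes nothing, so the sum equals its own negative. *)
Lemma constrained_count_free_arc D (Q : T -> pred nat) p : p \in D ->
  Q p.1 =1 predT -> Q p.2 =1 predT -> constrained_count D Q = 0%R.
Proof.
move=> pD Q1 Q2.
pose flip (R : {set T * T}) := if p \in R then R :\ p else p |: R.
have flipK : involutive flip.
  move=> R; rewrite /flip; case: (boolP (p \in R)) => pR.
    by rewrite !inE eqxx /= setD1K.
  by rewrite !inE eqxx /= setU1K.
have flip_sign R : ((-1) ^+ #|flip R| = - (-1) ^+ #|R| :> int)%R.
  rewrite /flip; case: (boolP (p \in R)) => pR; last by rewrite cardsU1 pR exprS mulN1r.
  by rewrite [in RHS](cardsD1 p) pR exprS mulN1r opprK.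
have flip_cond R : (flip R \subset D) && [forall v, Q v (rev_outdeg D (flip R) v)]
    = (R \subset D) && [forall v, Q v (rev_outdeg D R v)].
  congr (_ && _).
    rewrite /flip; case: (boolP (p \in R)) => pR; last by rewrite subUset sub1set pD.
    by rewrite -[in RHS](setD1K pR) subUset sub1set pD.
  apply: eq_forallb => v.
  have [->|v1] := eqVneq v p.1; first by rewrite !Q1.
  have [->|v2] := eqVneq v p.2; first by rewrite !Q2.
  congr (Q v _); apply: eq_bigr => q _.
  have [->|qp] := eqVneq q p.
    by rewrite /tail; do 2!case: ifP => _; rewrite ?(negPf v1) ?(negPf v2) ?[_ == v]eq_sym
      ?(negPf v1) ?(negPf v2).
  by rewrite /tail /flip; case: (p \in R); rewrite !inE (negPf qp).
have : constrained_count D Q = (- constrained_count D Q)%R.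
  rewrite {1}/constrained_count (reindex_inj (inv_inj flipK)) -sumrN /=.
  by apply: eq_big => R; rewrite ?flip_cond // flip_sign.
by move/eqP; rewrite -addr_eq0 -mulr2n mulrn_eq0 => /eqP.
Qed.

(** Group the sets [R] by their part outside [E] and by their degrees in [E]. Within a group all
    degrees in [D] are fixed, so [Q] holds throughout, and a nonzero group is a signed count on [E]
    up to a global sign. Here [b] and [c] are the degrees of a representative in [D] and in [E]. *)
Lemma constrained_count_restrict D E (Q : T -> pred nat) : E \subset D ->
  constrained_count D Q != 0%R ->
  exists c : T -> nat, signed_count E c != 0%R /\
    exists2 b : T -> nat, (forall v, c v <= b v) & forall v, Q v (b v).
Proof.
move=> sED nz.
pose h (R : {set T * T}) := (R :\: E, [ffun v => rev_outdeg E R v]).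
have [R0 /andP[sR0 /forallP QR0]] := sum_neq0_fiber _ _ h _ _ nz.
have hE R : h R == h R0 = (R :\: E == R0 :\: E) &&
    [forall v, rev_outdeg E R v == rev_outdeg E R0 v].
  rewrite /h xpair_eqE; congr (_ && _); apply/eqP/forallP => [/ffunP H v|H].
    by have := H v; rewrite !ffunE => ->.
  by apply/ffunP => v; rewrite !ffunE (eqP (H v)).
move=> nz0; exists (rev_outdeg E R0); split; last first.
  exists (rev_outdeg D R0) => // v.
  by rewrite (@rev_outdeg_split D E) // leq_addr.
apply: contraNneq nz0 => z0.
(* Gluing the fixed outer part of [R0] to a subset of [E]; intersection with [E] is the inverse on
   the chosen group. *)
pose f R := R :|: R0 :\: E.
have fE R : R \subset E -> f R :&: E = R.
  move=> /subsetP sRE; apply/setP => p; rewrite !inE; have := sRE p.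
  by case: (p \in E); rewrite /= ?andbT ?andbF ?orbF //; case: (p \in R) => // /(_ isT).
have revE R v : R \subset E -> rev_outdeg E (f R) v = rev_outdeg E R v.
  by move=> sRE; rewrite -[LHS](@rev_outdeg_setI E E) // fE.
have revDE R v : R \subset E -> rev_outdeg (D :\: E) (f R) v = rev_outdeg (D :\: E) R0 v.
  move=> /subsetP sRE; apply: eq_bigr => p; rewrite !inE /tail => /andP[pE _].
  by rewrite !inE pE (contraNF (@sRE p)).
rewrite (reindex_onto f (fun R => R :&: E)) /=; last first.
  by move=> R /andP[_]; rewrite hE => /andP[/eqP hR _]; rewrite /f -hR setID.
apply/eqP; transitivity (signed_count E (rev_outdeg E R0) * (-1) ^+ #|R0 :\: E|)%R; last first.
  by rewrite z0 mul0r.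
rewrite mulr_suml; apply: eq_big => R.
  apply/idP/idP => [/andP[/andP[_ hR] /eqP fR]|/andP[sRE /forallP cR]].
    have sRE : R \subset E by rewrite -fR subsetIr.
    move: hR; rewrite hE sRE => /andP[_ /forallP hR].
    by apply/forallP => v; rewrite -revE.
  rewrite fE // eqxx andbT hE -!andbA; apply/and4P; split.
  - by rewrite subUset (subset_trans sRE sED) (subset_trans (subsetDl _ _) sR0).
  - apply/forallP => v; rewrite (@rev_outdeg_split D E) // revE // (eqP (cR v)).
    by rewrite revDE // -rev_outdeg_split.
  - apply/eqP/setP => p; rewrite !inE; move: (subsetP sRE p).
    by case: (p \in E); rewrite /= ?andbT ?andbF ?orbF //; case: (p \in R) => // /(_ isT).
  - by apply/forallP => v; rewrite revE.
move=> /andP[_ /eqP fR]; have sRE : R \subset E by rewrite -fR subsetIr.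
rewrite -exprD -cardsUI [R :&: (R0 :\: E)](_ : _ = set0) ?cards0 ?addn0 //.
apply/setP => p; rewrite !inE; move: (subsetP sRE p).
by case: (p \in E); rewrite /= ?andbT ?andbF ?orbF //; case: (p \in R) => // /(_ isT).
Qed.

Definition arcs_within D U : {set T * T} := [set p in D | (p.1 \in U) && (p.2 \in U)].

(** The term [v \in S] in the conclusion is the token just lost: [a] drops strictly at the vertices
    of [S] left uncoloured, which keeps [a] below the number of tokens. *)
Lemma painter_move (e : rel T) D U S a :
  (forall u v, e u v -> ((u, v) \in D) || ((v, u) \in D)) ->
  S \subset U -> signed_count (arcs_within D U) a != 0%R ->
  exists2 I : {set T}, (I \subset S) && independent e I &
    exists2 a' : T -> nat, signed_count (arcs_within D (U :\: I)) a' != 0%R &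
      {in U :\: I, forall v, a' v + (v \in S) <= a v}.
Proof.
move=> eD sSU /(@signed_count_relax _ _ S)[I sIS].
set Q := (Q in constrained_count _ Q) => nz.
have QI v : v \in I -> Q v =1 predT.
  by move=> vI n; rewrite /Q vI (subsetP sIS).
exists I.
  rewrite sIS; apply/forall_inP => u uI; apply/forall_inP => v vI.
  apply: contra nz => /eD uvD; apply/eqP.
  have inU w : w \in I -> w \in U by move=> /(subsetP sIS)/(subsetP sSU).
  case/orP: uvD => pD.
    by apply: (@constrained_count_free_arc _ _ (u, v)); rewrite ?inE ?pD ?inU //; apply: QI.
  by apply: (@constrained_count_free_arc _ _ (v, u)); rewrite ?inE ?pD ?inU //; apply: QI.
have sub : arcs_within D (U :\: I) \subset arcs_within D U.
  by apply/subsetP => p; rewrite !inE => /and3P[-> /andP[_ ->] /andP[_ ->]].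
have [c [nzc [b cb Qb]]] := @constrained_count_restrict _ _ _ sub nz.
exists c => // v; rewrite inE => /andP[/negPf vI _].
have := cb v; have := Qb v; rewrite /Q vI /=.
by case: (v \in S) => [|/eqP <-]; lia.
Qed.

Lemma painter_wins_signed_count (e : rel T) D (f : T -> nat) U a :
  (forall u v, e u v -> ((u, v) \in D) || ((v, u) \in D)) ->
  {in U, forall v, a v < f v} ->
  signed_count (arcs_within D U) a != 0%R -> painter_wins e f U.
Proof.
move=> eD; have [n] := ubnP (\sum_v f v).
elim: n f U a => // n IH f U a; rewrite ltnS => le_fn lt_af nz.
(* With no tokens left, [a v < f v] on [U] forces [U] to be empty. *)
have [v fv|f0] := pickP (fun v => 0 < f v); last first.
  apply: pw_end => [v|]; first by have := f0 v; case: (f v).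
  by apply/eqP; rewrite -subset0; apply/subsetP => v /lt_af; have := f0 v; case: (f v).
apply: pw_step => [|S S0 fS]; first by exists v.
(* Lister's set may contain coloured vertices, so the answer is chosen inside [S :&: U]. *)
have [I /andP[sI indI] [a' nz' lea']] := @painter_move e D U _ a eD (subsetIr S U) nz.
exists I; split; first exact: subset_trans sI (subsetIl _ _).
split=> //; apply: IH nz' => [|w wUI].
  apply: leq_trans le_fn; have [w wS] := set0Pn _ S0.
  rewrite (bigD1 w) //= [X in _ < X](bigD1 w) //= wS -addSn.
  apply: leq_add; first by have := fS w wS; lia.
  by apply: leq_sum => u _; apply: leq_subr.
have := lea' w wUI; move: wUI; rewrite !inE => /andP[_ wU].
by rewrite wU andbT; have := lt_af w wU; case: (w \in S) => /=; lia.
Qed.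

Lemma AT_orientation_paintable (e : rel T) D (f : T -> nat) :
  AT_orientation e D -> (forall v, outdeg D v < f v) -> paintable e f.
Proof.
move=> /andP[/andP[/forallP orD _] neq] lt_f.
apply: (@painter_wins_signed_count e D f setT (outdeg D)) => [u v uv|v _|].
- by have := forallP (orD u) v; rewrite uv /= => /addbP; do 2!case: (_ \in _).
- exact: lt_f.
have -> : arcs_within D setT = D by apply/setP => p; rewrite !inE /= ?andbT.
by rewrite signed_count_outdeg subr_eq0 eqr_nat.
Qed.

End SignedCount.

Lemma paint_number_le_AT_number (T : finType) (e : rel T) :
  paint_number e <= AT_number e.
Proof.
rewrite /AT_number.
case: (bigminn_attained _ (AT_orientation e) (fun o => (\max_(v : T) outdeg o v).+1) #|T|.+1).
  by move=> ->; apply: bigminn_leq_default.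
move=> [o ATo ->]; set k := _.+1.
(* The minimum in [paint_number] ranges over [k <= #|T|]; a larger [k] is at least its default
   value. *)
have [ltk|] := ltnP k #|T|.+1; last first.
  by move=> le; apply: leq_trans le; apply: bigminn_leq_default.
apply: (@bigminn_leq _ _ _ _ (Ordinal ltk)); apply/asboolP.
by apply: AT_orientation_paintable ATo _ => v; rewrite ltnS; apply: leq_bigmax.
Qed.


(** * Orientations with prescribed lower bounds on indegrees *)

Section Orientations.
Variable T : finType.
Implicit Types (g : rel T) (o H : {set T * T}) (A B W X : {set T}).

Lemma is_orientationP g o :
  reflect ((forall u v, g u v -> ((u, v) \in o) (+) ((v, u) \in o)) /\
           (forall u v, (u, v) \in o -> g u v))
          (is_orientation g o).
Proof.
apply: (iffP andP) => -[H1 H2]; split.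
- by move=> u v uv; have /forallP/(_ v) := forallP H1 u; rewrite uv.
- by move=> u v uvo; apply: (forall_inP H2 (u, v)).
- by apply/forallP => u; apply/forallP => v; apply/implyP; apply: H1.
- by apply/forall_inP => -[u v]; apply: H2.
Qed.

Lemma sum_outdeg H A : \sum_(v in A) outdeg H v = #|[set p in H | p.1 \in A]|.
Proof.
under eq_bigr do rewrite outdegE; rewrite exchange_big -sum1_card /=.
rewrite [RHS](eq_bigl (fun p => (p \in H) && (p.1 \in A))); last by move=> p; rewrite inE.
rewrite big_mkcondr; apply: eq_bigr => p _ /=.
case: ifP => pA; last by rewrite big1 // => v vA; case: eqP => // pv; rewrite pv vA in pA.
by rewrite (bigD1 p.1) //= eqxx big1 // => v /andP[_ /negPf]; rewrite eq_sym => ->.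
Qed.

Lemma sum_indeg H A : \sum_(v in A) indeg H v = #|[set p in H | p.2 \in A]|.
Proof.
under eq_bigr do rewrite indegE; rewrite exchange_big -sum1_card /=.
rewrite [RHS](eq_bigl (fun p => (p \in H) && (p.2 \in A))); last by move=> p; rewrite inE.
rewrite big_mkcondr; apply: eq_bigr => p _ /=.
case: ifP => pA; last by rewrite big1 // => v vA; case: eqP => // pv; rewrite pv vA in pA.
by rewrite (bigD1 p.2) //= eqxx big1 // => v /andP[_ /negPf]; rewrite eq_sym => ->.
Qed.

(** Sums the balance condition over [A]. It serves both to exclude arcs across a cut and to compare
    the two directions in a bipartite piece. *)
Lemma eulerian_cut H A : eulerian H ->
  #|[set p in H | p.1 \in A]| = #|[set p in H | p.2 \in A]|.
Proof.
move=> /forallP eulH; rewrite -sum_outdeg -sum_indeg.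
by apply: eq_bigr => v _; apply/eqP.
Qed.

Lemma outdeg_card H v : outdeg H v = #|[set u | (v, u) \in H]|.
Proof.
rewrite -(card_imset [set u | (v, u) \in H] (f := pair v)); last by move=> x y [].
apply: eq_card => -[x y]; rewrite !inE /=; apply/idP/imsetP => [/andP[xyH /eqP <-]|[u]].
  by exists y; rewrite ?inE.
by rewrite inE => vuH [-> ->]; rewrite vuH eqxx.
Qed.

Lemma indeg_card H v : indeg H v = #|[set u | (u, v) \in H]|.
Proof.
rewrite -(card_imset [set u | (u, v) \in H] (f := pair^~ v)); last by move=> x y [].
apply: eq_card => -[x y]; rewrite !inE /=; apply/idP/imsetP => [/andP[xyH /eqP <-]|[u]].
  by exists x; rewrite ?inE.
by rewrite inE => vuH [-> ->]; rewrite vuH eqxx.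
Qed.

Section Symmetric.
Variable g : rel T.
Hypotheses (sym_g : symmetric g) (irr_g : irreflexive g).

Lemma orientation_degree o v : is_orientation g o ->
  outdeg o v + indeg o v = #|[set u | g v u]|.
Proof.
move=> /is_orientationP[or1 or2]; rewrite outdeg_card indeg_card -cardsUI.
rewrite [_ :&: _](_ : _ = set0) ?cards0 ?addn0.
  apply: eq_card => u; rewrite !inE; apply/orP/idP => [[/or2//|/or2]|/or1].
    by rewrite sym_g.
  by do 2!case: (_ \in _) => //; [left|right].
apply/setP => u; rewrite !inE; apply/negbTE/andP => -[vu uv].
by have := or1 _ _ (or2 _ _ vu); rewrite vu uv.
Qed.

Lemma orientation_exists : exists o, is_orientation g o.
Proof.
exists [set p | g p.1 p.2 && (enum_rank p.1 < enum_rank p.2)].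
apply/is_orientationP; split=> u v; rewrite !inE /=; last by case/andP.
move=> uv; rewrite (sym_g v) uv /=; case: ltngtP => // /val_inj/enum_rank_inj E.
by rewrite E irr_g in uv.
Qed.

Lemma orientation_flip o x y : is_orientation g o -> (x, y) \in o ->
  let o' := (y, x) |: o :\ (x, y) in
  is_orientation g o' /\
  forall z, indeg o' z + (z == y) = indeg o z + (z == x).
Proof.
move=> oo xyo; have [or1 or2] := is_orientationP _ _ oo.
have gxy := or2 _ _ xyo.
have xy : x != y by apply: contraTneq gxy => ->; rewrite irr_g.
have yxo : (y, x) \notin o by have := or1 _ _ gxy; rewrite xyo.
split.
  apply/is_orientationP; split=> u v; rewrite !inE !xpair_eqE.
    move=> /or1; rewrite [(v == y) && _]andbC [(v == x) && _]andbC.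
    case: (boolP ((u == x) && (v == y))) => [/andP[/eqP-> /eqP->]|_].
      by rewrite (negPf xy).
    by case: (boolP ((u == y) && (v == x))) => [/andP[/eqP-> /eqP->]|_].
  by case/orP=> [/andP[/eqP-> /eqP->]|/andP[_ /or2//]]; rewrite sym_g.
move=> z; rewrite !indegE big_setU1 /= ?inE ?(negPf yxo) ?andbF //.
by rewrite [in RHS](big_setD1 (x, y)) //= ![_ == z]eq_sym addnC addnCA addnC.
Qed.

(** Reversing a directed path moves one unit of indegree from its end to its start. The tail of the
    path is reversed first; the clause on arcs leaving vertices off the path guarantees that the
    first arc is still present. *)
Lemma path_reversal o x p : is_orientation g o ->
  path (fun u v => (u, v) \in o) x p -> uniq (x :: p) ->
  exists2 o', is_orientation g o' &
    (forall u v, u \notin x :: p -> ((u, v) \in o') = ((u, v) \in o)) /\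
    forall z, indeg o' z + (z == last x p) = indeg o z + (z == x).
Proof.
elim: p x => [|y p IH] x oo /=; first by exists o.
move=> /andP[xyo yp] /andP[xyp uyp].
have [o1 oo1 [eq1 in1]] := IH y oo yp uyp.
have xyo1 : (x, y) \in o1 by rewrite eq1.
have [oo2 in2] := @orientation_flip _ _ _ oo1 xyo1.
eexists; first exact: oo2.
split=> [u v|z]; last by have := in2 z; have := in1 z; lia.
rewrite !inE !xpair_eqE => /norP[ux /norP[uy up]].
by rewrite (negPf ux) (negPf uy) /= eq1 // !inE negb_or uy.
Qed.

(** Minimise the total deficit. If [v] is deficient, no vertex reachable from [v] has surplus, since
    reversing a path to it would lower the deficit. The reachable set [A] has no outgoing arcs, so
    its degree sum is at most twice its indegree sum, hence less than twice the sum of [t], a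
    contradiction. *)
Lemma orientation_indeg_ge (t : T -> nat) :
  (forall v, 2 * t v <= #|[set u | g v u]|) ->
  exists2 o, is_orientation g o & forall v, t v <= indeg o v.
Proof.
move=> le_t; have [o0 oo0] := orientation_exists.
pose deficit o := \sum_v (t v - indeg o v).
case: (@arg_minnP _ o0 (is_orientation g) deficit oo0) => o oo min_o.
exists o => // v; rewrite leqNgt; apply/negP => lt_v.
pose A := [set w | connect (fun x y => (x, y) \in o) v w].
have vA : v \in A by rewrite inE connect0.
have leA w : w \in A -> indeg o w <= t w.
  rewrite inE => /connectP[p0 p0P ->]; case: (shortenP p0P) => p pP up _.
  rewrite leqNgt; apply/negP => lt_w; move: lt_w; set w' := last v p => lt_w.
  have vw : v != w' by apply: contraTneq lt_w => <-; rewrite -leqNgt ltnW.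
  have [o' oo' [_ in']] := @path_reversal _ _ _ oo pP up.
  have := min_o _ oo'; rewrite leqNgt => /negP[].
  rewrite /deficit (bigD1 v) //= [X in _ < X](bigD1 v) //= -addSn.
  apply: leq_add.
    by have := in' v; rewrite eqxx (negPf vw); lia.
  apply: leq_sum => z zv; have := in' z; rewrite (negPf zv) -/w'.
  by case: eqVneq => [->|_]; lia.
have out_in : \sum_(w in A) outdeg o w <= \sum_(w in A) indeg o w.
  rewrite sum_outdeg sum_indeg; apply: subset_leq_card; apply/subsetP => -[x y].
  rewrite !inE /= => /andP[xyo vx]; rewrite xyo /=.
  exact: connect_trans vx (connect1 _).
have : 2 * (\sum_(w in A) t w) <= \sum_(w in A) (outdeg o w + indeg o w).
  by rewrite big_distrr /=; apply: leq_sum => w _; rewrite orientation_degree.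
rewrite big_split /=.
have : \sum_(w in A) indeg o w < \sum_(w in A) t w.
  rewrite (bigD1 v) //= [X in _ < X](bigD1 v) //= -addSn; apply: leq_add => //.
  by apply: leq_sum => w /andP[/leA].
by lia.
Qed.

End Symmetric.
End Orientations.


(** * Peeling off bipartite pieces *)

Section Decomposition.
Variables (T : finType) (e : rel T).
Hypotheses (sym_e : symmetric e) (irr_e : irreflexive e).
Implicit Types (W X : {set T}) (v : T) (o H : {set T * T}).

Definition induced W : rel T := fun u v => [&& e u v, u \in W & v \in W].

Definition deg_in W v : nat := #|[set u in W | e v u]|.

Lemma deg_inE W v : deg_in W v = \sum_(u in W) e v u.
Proof.
rewrite /deg_in -sum1_card -big_mkcondr /=.
by apply: eq_bigl => u; rewrite inE.
Qed.

Lemma deg_in_setD W X v : X \subset W -> deg_in W v = deg_in X v + deg_in (W :\: X) v.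
Proof. by move=> /setIidPr sXW; rewrite !deg_inE (big_setID X) /= sXW. Qed.

Definition bipartite_in X := exists b : pred T, {in X &, forall u v, e u v -> b u != b v}.

(** The last clause implies the Alon-Tarsi condition: [EO] is zero, while [EE] counts at least the
    empty subgraph. *)
Definition good_orientation k W o :=
  [/\ is_orientation (induced W) o, forall v, outdeg o v <= k &
      forall H, H \subset o -> eulerian H -> ~~ odd #|H|].

Lemma induced_orientation_exists X (t : T -> nat) :
  {in X, forall v, 2 * t v <= deg_in X v} ->
  exists2 o, is_orientation (induced X) o &
    {in X, forall v, outdeg o v + t v <= deg_in X v}.
Proof.
move=> le_t.
have sym_X : symmetric (induced X) by move=> u v; rewrite /induced sym_e [_ && (v \in X)]andbC.
have irr_X : irreflexive (induced X) by move=> u; rewrite /induced irr_e.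
have degX v : v \in X -> #|[set u | induced X v u]| = deg_in X v.
  by move=> vX; apply: eq_card => u; rewrite !inE /induced vX andbC.
have [v|o oo le_in] :=
  @orientation_indeg_ge _ _ sym_X irr_X (fun v => if v \in X then t v else 0).
  by case: ifP => // vX; rewrite degX // le_t.
exists o => // v vX; rewrite -degX // -(@orientation_degree _ _ sym_X _ v oo).
by have := le_in v; rewrite vX leq_add2l.
Qed.

Lemma good_orientation_extend k W X oY : X \subset W -> bipartite_in X ->
  {in X, forall v, 2 * (deg_in W v - k) <= deg_in X v} ->
  good_orientation k (W :\: X) oY -> exists o, good_orientation k W o.
Proof.
move=> sXW [b bX] degX [orY outY evenY].
have [oX orX outX] := induced_orientation_exists _ _ degX.
have [orX1 orX2] := is_orientationP _ _ _ orX.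
have [orY1 orY2] := is_orientationP _ _ _ orY.
pose o := oX :|: oY :|: [set p | [&& e p.1 p.2, p.1 \in X & p.2 \in W :\: X]].
have memo u v : ((u, v) \in o) =
    if u \in X then ((u, v) \in oX) || (e u v && (v \in W :\: X)) else (u, v) \in oY.
  rewrite !inE /=; case: ifPn => uX.
    case: (boolP ((u, v) \in oY)) => [/orY2/and3P[]|_]; last by rewrite orbF.
    by rewrite inE uX.
  rewrite /= andbF orbF; case: (boolP ((u, v) \in oX)) => // /orX2/and3P[_].
  by rewrite (negPf uX).
exists o; split.
- apply/is_orientationP; split=> u v; rewrite !memo.
    case/and3P=> uv uW vW; rewrite [e v u]sym_e uv !inE uW vW !andbT.
    case: (boolP (u \in X)) => uX; case: (boolP (v \in X)) => vX /=; rewrite ?orbF ?orbT.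
    + by apply: orX1; apply/and3P.
    + by case: (boolP (_ \in oY)) => [/orY2/and3P[_ _]|//]; rewrite inE uX.
    + by case: (boolP (_ \in oY)) => [/orY2/and3P[_ _]|//]; rewrite inE vX.
    + by apply: orY1; apply/and3P; split=> //; rewrite inE ?uX ?vX.
  case: ifP => uX.
    case/orP=> [/orX2/and3P[uv uX' vX]|/andP[uv]].
      by rewrite /induced uv !(subsetP sXW).
    by rewrite inE => /andP[_ vW]; rewrite /induced uv vW (subsetP sXW).
  case/orY2/and3P=> uv; rewrite !inE => /andP[_ uW] /andP[_ vW].
  exact/and3P.
- move=> v; case: (boolP (v \in X)) => vX.
    have := outX v vX; have := deg_in_setD _ _ v sXW.
    have : outdeg o v <= outdeg oX v + deg_in (W :\: X) v.
      rewrite !outdeg_card; apply: leq_trans (leq_card_setU _ _).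
      by apply: subset_leq_card; apply/subsetP => u; rewrite in_set memo vX !inE (andbC (e v u)).
    by lia.
  rewrite outdeg_card; apply: leq_trans (outY v); rewrite outdeg_card.
  by apply: subset_leq_card; apply/subsetP => u; rewrite in_set memo (negPf vX) in_set.
move=> H sHo eulH.
(* No arc of [o] enters [X] from outside, which gives one inclusion; the cut identity for [X] makes
   it an equality. Thus [H] has no arc between [X] and its complement. *)
have closedX : [set p in H | p.2 \in X] = [set p in H | p.1 \in X].
  apply/eqP; rewrite eqEcard -(@eulerian_cut _ _ X eulH) leqnn andbT.
  apply/subsetP => -[u v]; rewrite !inE /= => /andP[uvH vX]; rewrite uvH /=.
  have := subsetP sHo _ uvH; rewrite memo; case: ifP => // _ /orY2/and3P[_ _].
  by rewrite inE vX.
have inX u v : (u, v) \in H -> (v \in X) = (u \in X).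
  by move=> uvH; have /setP/(_ (u, v)) := closedX; rewrite !inE /= uvH.
pose HY := [set p in H | p.1 \notin X].
have evenHY : ~~ odd #|HY|.
  apply: evenY.
    apply/subsetP => -[u v]; rewrite inE /= => /andP[uvH uX].
    by have := subsetP sHo _ uvH; rewrite memo (negPf uX).
  apply/forallP => v; rewrite outdeg_card indeg_card.
  have := forallP eulH v; rewrite outdeg_card indeg_card.
  case: (boolP (v \in X)) => vX.
    move=> _; rewrite !eq_card0 // => u; rewrite !inE /= ?vX ?andbF //.
    by case: (boolP (_ \in H)) => //= /inX <-; rewrite vX.
  congr (is_true (_ == _)); apply: eq_card => u; rewrite !inE /= ?vX ?andbT //.
  by case: (boolP (_ \in H)) => //= /inX <-; rewrite vX.
(* [A] is one side of [X]. Arcs of [H] with head in [A] are those leaving the other side, so the cut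
   identity for [A] shows that equally many arcs run in each direction: [H] has an even number of
   arcs inside [X]. *)
pose A := [set v in X | b v].
have bipA : [set p in H | p.2 \in A] = [set p in H | (p.1 \in X) && ~~ b p.1].
  apply/setP => -[u v]; rewrite !inE /=; case: (boolP (_ \in H)) => //= uvH.
  rewrite (inX _ _ uvH); case: (boolP (u \in X)) => //= uX.
  have := subsetP sHo _ uvH; rewrite memo uX inE (inX _ _ uvH) uX /= andbF orbF.
  by case/orX2/and3P=> uv _ vX; have := bX _ _ uX vX uv; do 2!case: (b _).
have := @eulerian_cut _ _ A eulH; rewrite bipA => cardA.
rewrite -(cardsID [set p | p.1 \in X] H) (_ : H :\: _ = HY); last first.
  by apply/setP => p; rewrite !inE andbC.
rewrite oddD (negPf evenHY) addbF -(cardsID [set p | b p.1]).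
rewrite (_ : _ :&: _ = [set p in H | p.1 \in A]); last first.
  by apply/setP => p; rewrite !inE andbA.
rewrite cardA (_ : _ :\: _ = [set p in H | (p.1 \in X) && ~~ b p.1]) ?addnn ?odd_double //.
by apply/setP => p; rewrite !inE andbC andbA.
Qed.

Lemma good_orientation_exists k :
  (forall W, W != set0 -> exists X, [/\ X \subset W, X != set0, bipartite_in X &
     {in X, forall v, 2 * (deg_in W v - k) <= deg_in X v}]) ->
  forall W, exists o, good_orientation k W o.
Proof.
move=> ex W; have [n] := ubnP #|W|; elim: n W => // n IH W; rewrite ltnS => leW.
have [->|W0] := eqVneq W set0.
  exists set0; split=> [|v|H].
  - by apply/is_orientationP; split=> u v; rewrite /induced !inE ?andbF.
  - by rewrite outdeg_card eq_card0 // => u; rewrite !inE.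
  by rewrite subset0 => /eqP ->; rewrite cards0.
have [X [sXW X0 bipX degX]] := ex W W0.
have [|oY goodY] := IH (W :\: X); last exact: good_orientation_extend goodY.
have := subset_leq_card sXW; have : 0 < #|X| by rewrite card_gt0.
by rewrite cardsDS //; lia.
Qed.

(** Deleting a vertex of degree at most [m] lowers the degree sum by at most [2 * m]. *)
Lemma sum_deg_in_degenerate m W :
  (forall X, X \subset W -> X != set0 -> exists2 v, v \in X & deg_in X v <= m) ->
  \sum_(v in W) deg_in W v <= 2 * m * #|W|.
Proof.
have [n] := ubnP #|W|; elim: n W => // n IH W; rewrite ltnS => leW degen.
have [->|W0] := eqVneq W set0; first by rewrite big_set0.
have [v vW degv] := degen W (subxx _) W0.
have cW := cardsD1 v W; rewrite vW in cW.
have /IH : #|W :\ v| < n by lia.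
have -> : \sum_(x in W) deg_in W x =
    2 * deg_in W v + \sum_(x in W :\ v) deg_in (W :\ v) x.
  have degD x : deg_in W x = e x v + deg_in (W :\ v) x.
    by rewrite !deg_inE (big_setD1 v).
  rewrite (big_setD1 v) //= (eq_bigr _ (fun x _ => degD x)) big_split /=.
  have -> : \sum_(x in W :\ v) e x v = deg_in W v.
    rewrite degD irr_e deg_inE; apply: eq_bigr => x _; by rewrite sym_e.
  by rewrite addnA mul2n addnn.
move=> IHv; rewrite cW mulnDr muln1; apply: leq_add.
  by rewrite leq_mul2l.
apply: IHv => X sX; apply: degen; exact: subset_trans sX (subsetDl _ _).
Qed.

Lemma big_setI_cond (A B : {set T}) (F : T -> nat) :
  \sum_(v in A :&: B) F v = \sum_(v in A) (if v \in B then F v else 0).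
Proof. by rewrite -big_mkcondr; apply: eq_bigl => v; rewrite inE. Qed.

Section Colouring.
Variables (r : nat) (c : T -> 'I_r).
Hypothesis proper_c : forall u v, e u v -> c u != c v.

(** The pairs are ordered and may have equal entries, which keeps the double counts below simple. *)
Definition two_classes (ij : 'I_r * 'I_r) : {set T} := [set v | (c v == ij.1) || (c v == ij.2)].

Lemma bipartite_two_classes ij X : X \subset two_classes ij -> bipartite_in X.
Proof.
move=> /subsetP sX; exists (fun v => c v == ij.1) => u v /sX uI /sX vI /proper_c.
apply: contra_neq => E; move: uI vI; rewrite !inE E.
case: (eqVneq (c v) ij.1) => [vi _ _|_ /= /eqP-> /eqP-> //].
by apply/eqP; rewrite vi E vi.
Qed.

Lemma sum_two_classes_card W : \sum_ij #|W :&: two_classes ij| <= 2 * r * #|W|.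
Proof.
under eq_bigr do rewrite -sum1_card big_setI_cond.
rewrite exchange_big mulnC -sum_nat_const; apply: leq_sum => v _ /=.
rewrite -big_mkcond sum1_card /=.
(* The pairs containing [c v] form a row and a column of the square of colours; counting their
   common cell twice only weakens the bound. *)
pose B1 := setX [set c v] [set: 'I_r]; pose B2 := setX [set: 'I_r] [set c v].
have -> : 2 * r = #|B1| + #|B2|.
  by rewrite !cardsX !cards1 !cardsT !card_ord mul1n muln1 mul2n addnn.
apply: leq_trans (leq_card_setU _ _); apply: subset_leq_card.
apply/subsetP => -[i j] vij; have : v \in two_classes (i, j) by exact: vij.
by rewrite !inE /= andbT ![c v == _]eq_sym.
Qed.

(** The ends of an edge have distinct colours, so the edge is counted for both orderings of that
    pair of colours. *)
Lemma sum_two_classes_deg W :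
  2 * (\sum_(v in W) deg_in W v) <=
  \sum_ij \sum_(v in W :&: two_classes ij) deg_in (W :&: two_classes ij) v.
Proof.
pose both ij u v := (u \in two_classes ij) && (v \in two_classes ij).
have -> : \sum_ij \sum_(v in W :&: two_classes ij) deg_in (W :&: two_classes ij) v =
    \sum_(v in W) \sum_(u in W) \sum_ij e v u * both ij v u.
  under [RHS]eq_bigr do rewrite exchange_big.
  rewrite [RHS]exchange_big; apply: eq_bigr => ij _ /=.
  rewrite big_setI_cond; apply: eq_bigr => v _; rewrite /both.
  case: (v \in _); last by rewrite big1 // => u _; rewrite muln0.
  rewrite deg_inE big_setI_cond; apply: eq_bigr => u _ /=.
  by case: (u \in _); rewrite ?muln1 ?muln0.
rewrite big_distrr; apply: leq_sum => v vW /=.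
rewrite deg_inE big_distrr; apply: leq_sum => u uW /=.
rewrite -big_distrr mulnC /=; case: (boolP (e v u)) => // /proper_c cvu.
rewrite !mul1n (bigD1 (c v, c u)) // (bigD1 (c u, c v)) /=; last first.
  by rewrite xpair_eqE negb_and eq_sym cvu.
by rewrite /both !inE !eqxx !orbT.
Qed.

Lemma bipartite_subset_exists d k W : 4 * r * (d - k) <= k ->
  (forall v, #|[set u | e v u]| <= d) -> W != set0 ->
  exists X, [/\ X \subset W, X != set0, bipartite_in X &
     {in X, forall v, 2 * (deg_in W v - k) <= deg_in X v}].
Proof.
move=> le_k le_d W0.
(* A vertex of degree at most [k] in [W] works alone: its required degree in [X] is zero. *)
have [v /andP[vW degv]|big_deg] := pickP (fun v => (v \in W) && (deg_in W v <= k)).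
  exists [set v]; split.
  - by rewrite sub1set.
  - by apply/set0Pn; exists v; rewrite inE.
  - by exists predT => u w /set1P-> /set1P->; rewrite irr_e.
  by move=> u /set1P->; rewrite (eqP degv).
apply: contrapT => no_X.
have le_t v : deg_in W v - k <= d - k.
  apply/leq_sub2r/(leq_trans _ (le_d v))/subset_leq_card/subsetP => u.
  by rewrite !inE => /andP[].
have degen ij : \sum_(v in W :&: two_classes ij) deg_in (W :&: two_classes ij) v
    <= 4 * (d - k) * #|W :&: two_classes ij|.
  have -> : 4 * (d - k) = 2 * (2 * (d - k)) by rewrite mulnA.
  apply: sum_deg_in_degenerate => X; rewrite subsetI => /andP[sXW sXc] X0.
  have [v /andP[vX degv]|all_deg] :=
    pickP (fun v => (v \in X) && (deg_in X v <= 2 * (d - k))); first by exists v.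
  (* A subgraph of two classes with all degrees above [2 * (d - k)] would be a valid [X], so every
     such union is degenerate. *)
  case: no_X; exists X; split=> // [|v vX]; first exact: bipartite_two_classes sXc.
  have := all_deg v; rewrite vX /= => /negbT; rewrite -ltnNge => /ltnW.
  by apply: leq_trans; rewrite leq_mul2l le_t.
have : (k.+1) * #|W| <= \sum_(v in W) deg_in W v.
  rewrite mulnC -sum_nat_const; apply: leq_sum => v vW.
  by have := big_deg v; rewrite vW /= => /negbT; rewrite -ltnNge.
have := sum_two_classes_deg W.
have : \sum_ij \sum_(v in W :&: two_classes ij) deg_in (W :&: two_classes ij) v <=
    4 * (d - k) * \sum_ij #|W :&: two_classes ij|.
  by rewrite big_distrr; apply: leq_sum.
have := sum_two_classes_card W; have : 0 < #|W| by rewrite card_gt0.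
(* With [s] the degree sum of [W], the bounds give [2 * s <= 4 * (d - k) * (2 * r * #|W|)], hence
   [s <= k * #|W|] by [le_k], against [s >= k.+1 * #|W|]. *)
move: (\sum_ij _) (\sum_ij _) (\sum_(v in W) _) => a b s.
by nia.
Qed.

End Colouring.
End Decomposition.

(** * The bound on the Alon-Tarsi number *)

Lemma colouring_exists (T : finType) (e : rel T) (r : nat) : irreflexive e ->
  chromatic_number e <= r -> exists c : T -> 'I_r, forall u v, e u v -> c u != c v.
Proof.
move=> irr_e.
suff [k le_k [c cP]] : exists2 k, k <= chromatic_number e &
    exists c : T -> 'I_k, forall u v, e u v -> c u != c v.
  move=> le_r; exists (fun v => widen_ord (leq_trans le_k le_r) (c v)) => u v /cP.
  by apply: contra => /eqP/(congr1 val)/= /val_inj ->.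
rewrite /chromatic_number.
case: (bigminn_attained _ (fun k : 'I_#|T|.+1 => colorable e k) val #|T|) => [->|[k /existsP[c cP] ->]].
  (* The default value [#|T|] is realised by giving every vertex its own colour. *)
  exists #|T| => //; exists enum_rank => u v uv; rewrite (inj_eq enum_rank_inj).
  by apply: contraTneq uv => ->; rewrite irr_e.
exists k => //; exists c => u v uv.
by have /forallP/(_ v) := forallP cP u; rewrite uv.
Qed.

Lemma AT_number_le_good_orientation (T : finType) (e : rel T) k o :
  good_orientation T e k setT o -> AT_number e <= k.+1.
Proof.
move=> [oro outo eveno].
have AT : AT_orientation e o.
  apply/andP; split.
    have [or1 or2] := is_orientationP _ _ _ oro; apply/is_orientationP; split=> u v.
      by move=> uv; apply: or1; rewrite /induced uv !inE.
    by move=> /or2/and3P[].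
  rewrite /EO eq_card0 => [|H]; last first.
    rewrite !inE; apply/negbTE/andP => -[/andP[/eveno even /even]].
    by move=> /negPf ->.
  rewrite -lt0n; apply/card_gt0P; exists set0; rewrite !inE sub0set cards0 andbT /=.
  by apply/forallP => v; rewrite outdeg_card indeg_card !eq_card0 // => u; rewrite !inE.
apply: leq_trans (bigminn_leq _ _ _ _ _ AT) _.
by rewrite ltnS; apply/bigmax_leqP => v _.
Qed.

Lemma AT_number_le (T : finType) (e : rel T) (d r : nat) :
  symmetric e -> irreflexive e -> (forall v, #|[set u | e v u]| <= d) ->
  chromatic_number e <= r ->
  AT_number e <= (4 * r * d) %/ (4 * r + 1) + 2.
Proof.
move=> sym_e irr_e le_d chi; have [c cP] := colouring_exists _ _ _ irr_e chi.
set q := _ %/ _.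
(* Source of the constant [4 * r + 1]: [k = q.+1] is the least integer above
   [4 * r * d / (4 * r + 1)], and [k * (4 * r + 1) > 4 * r * d] rearranges to the condition needed
   for the pieces. *)
have le_k : 4 * r * (d - q.+1) <= q.+1.
  have : 4 * r * d < q.+1 * (4 * r + 1) by apply: ltn_ceil; rewrite addn1.
  by rewrite mulnBr mulnDr; lia.
have [W W0|o goodo] := good_orientation_exists _ _ sym_e irr_e q.+1 _ setT.
  exact: bipartite_subset_exists sym_e irr_e _ _ cP _ _ _ le_k le_d W0.
by rewrite addn2; apply: AT_number_le_good_orientation goodo.
Qed.

Theorem theorem1p2 (T : finType) (e : rel T) (d r : nat) :
  symmetric e -> irreflexive e -> (2 <= r)%N ->
  (forall v : T, (#|[set u | e v u]| <= d)%N) ->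
  (chromatic_number e <= r)%N ->
  (paint_number e <= AT_number e)%N /\
  ((AT_number e)%:R <= (1 - 1 / (4 * r + 1)%:R) * d%:R + 2 :> rat)%R.
Proof.
move=> sym_e irr_e _ le_d chi; split; first exact: paint_number_le_AT_number.
have := AT_number_le _ _ _ _ sym_e irr_e le_d chi; set q := _ %/ _ => le_AT.
have m_gt0 : (0 < (4 * r + 1)%:R :> rat)%R by rewrite ltr0n addn1.
(* As [1 - 1 / (4 * r + 1)] equals [4 * r / (4 * r + 1)], the bound becomes the rational quotient
   whose floor is [q], plus 2. *)
have -> : ((1 - 1 / (4 * r + 1)%:R) * d%:R = (4 * r * d)%:R / (4 * r + 1)%:R :> rat)%R.
  apply: (mulIf (lt0r_neq0 m_gt0)); rewrite mulfVK ?lt0r_neq0 // mulrAC mulrBl div1r mulVf ?lt0r_neq0 //.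
  by rewrite mul1r natrD addrK -natrM.
apply: (@Order.POrderTheory.le_trans _ _ (q + 2)%:R%R); first by rewrite ler_nat.
by rewrite natrD lerD2r ler_pdivlMr // -natrM ler_nat leq_divM.
Qed.
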